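(* Let $\gamma_D$ and $\gamma_E$ be independent nonnegative random variables, where for $i\in\{D,E\}$ the variable $\gamma_i$ is the instantaneous SNR of a fluctuating two-ray (FTR) fading channel with parameters $m_i>0$, $K_i\ge 0$, $\Delta_i\in[0,1]$, $\sigma_i^2>0$, i.e. $\gamma_i$ has the density $f_i$ given in the context, with coefficients $d_{j_i}$ as defined there. Let $R_s\ge 0$, $\Theta=e^{R_s}$, and $C_s(\gamma_D,\gamma_E)=\max\{\ln(1+\gamma_D)-\ln(1+\gamma_E),0\}$. Then the secrecy outage probability $$SOP=P\{C_s(\gamma_D,\gamma_E)<R_s\}=P\{\gamma_D<\Theta\gamma_E+\Theta-1\}$$ equals $$ \begin{aligned} SOP={}&\frac{m_D^{m_D}m_E^{m_E}}{\Gamma(m_D)\Gamma(m_E)}\sum_{j_D=0}^\infty\sum_{j_E=0}^\infty\frac{K_D^{j_D}d_{j_D}K_E^{j_E}d_{j_E}}{j_D!\,j_E!}\\ &\times\Bigg(1-\sum_{n=0}^{j_D}\sum_{q=0}^{n}\binom{n}{q}\frac{1}{n!\,j_E!}\exp\Big(-\frac{\Theta-1}{2\sigma_D^2}\Big)\frac{\Theta^q(\Theta-1)^{n-q}\,\Gamma(j_E+1+q)\,(2\sigma_E^2)^q}{\Big(1+\frac{\sigma_E^2\Theta}{\sigma_D^2}\Big)^{j_E+q+1}(2\sigma_D^2)^n}\Bigg). \end{aligned} $$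
   Context: For $i\in\{D,E\}$ ($D$: main channel to the legitimate receiver; $E$: eavesdropper channel), the FTR fading SNR $\gamma_i$ has probability density on $(0,\infty)$ $$f_i(\gamma)=\frac{m_i^{m_i}}{\Gamma(m_i)}\sum_{j_i=0}^\infty \frac{K_i^{j_i}d_{j_i}}{j_i!\,j_i!}\,\frac{\gamma^{j_i}}{(2\sigma_i^2)^{j_i+1}}\exp\Big(-\frac{\gamma}{2\sigma_i^2}\Big),$$ and cumulative distribution function $$F_i(\gamma)=\frac{m_i^{m_i}}{\Gamma(m_i)}\sum_{j_i=0}^\infty \frac{K_i^{j_i}d_{j_i}}{j_i!\,j_i!}\,\gamma\Big(j_i+1,\frac{\gamma}{2\sigma_i^2}\Big),$$ where $\gamma(a,x)=\int_0^x t^{a-1}e^{-t}\,dt$ is the lower incomplete gamma function. The coefficients $d_{j_i}$ depend on $(m_i,K_i,\Delta_i)$ and the index $j_i$ (so $d_{j_D}$ uses the parameters of channel $D$ and $d_{j_E}$ those of channel $E$): $$d_{j_i}=\frac{\Gamma(j_i+m_i)}{\pi}\int_0^{\pi}\frac{(1+\Delta_i\cos\theta)^{j_i}}{(m_i+K_i+K_i\Delta_i\cos\theta)^{j_i+m_i}}\,d\theta .$$ The paper defines the secrecy outage probability by the integral $SOP=\int_0^\infty F_D(\Theta\gamma+\Theta-1)f_E(\gamma)\,d\gamma=P\{\gamma_D<\Theta\gamma_E+\Theta-1\}$. At $R_s=0$ (where $\{C_s<0\}$ is empty) $SOP$ is understood as $P\{\gamma_D<\Theta\gamma_E+\Theta-1\}$.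 The natural logarithm is used, and the convention $0^0=1$ is used. *)

(* Defs.v *)
From HB Require Import structures.
From mathcomp Require Import all_boot all_order all_algebra.
From mathcomp Require Import all_classical all_reals all_analysis.
Import Order.TTheory GRing.Theory Num.Theory.
Import numFieldNormedType.Exports.

Set Implicit Arguments.
Unset Strict Implicit.
Unset Printing Implicit Defensive.

Local Open Scope classical_set_scope.
Local Open Scope ring_scope.

Definition Gamma (R : realType) (a : R) : R :=
  \int[@lebesgue_measure R]_(t in `]0%R, +oo[) (t `^ (a - 1) * expR (- t)).

Definition independent_RV (d : measure_display) (T : measurableType d)
    (R : realType) (P : probability T R) (X Y : {RV P >-> R}) : Prop :=
  forall A B : set R, measurable A -> measurable B ->
    P (X @^-1` A `&` Y @^-1` B) = (P (X @^-1` A) * P (Y @^-1` B))%E.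

(* [x `^ y] is the real power; [x ^+ j] the natural power, with 0 ^+ 0 = 1. *)
Definition ftr_coef (R : realType) (m K Delta : R) (j : nat) : R :=
  Gamma (j%:R + m) / pi *
  \int[@lebesgue_measure R]_(theta in `[0%R, pi])
    ((1 + Delta * cos theta) ^+ j /
     (m + K + K * Delta * cos theta) `^ (j%:R + m)).

(* In the next two definitions [s2] stands for sigma^2. *)
Definition ftr_density (R : realType) (m K Delta s2 : R) (x : R) : R :=
  m `^ m / Gamma m *
  limn (series (fun j : nat =>
    K ^+ j * ftr_coef m K Delta j / (j`!%:R * j`!%:R) *
    (x ^+ j / (2 * s2) ^+ j.+1) * expR (- (x / (2 * s2))))).

(* The density is carried by ]0, +oo[, the law giving no mass elsewhere. *)
Definition is_FTR (d : measure_display) (T : measurableType d)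
    (R : realType) (P : probability T R) (m K Delta s2 : R)
    (X : {RV P >-> R}) : Prop :=
  forall A : set R, measurable A ->
    P (X @^-1` A) =
    (\int[@lebesgue_measure R]_(x in A `&` `]0%R, +oo[)
       (ftr_density m K Delta s2 x)%:E)%E.

Definition secrecy_capacity (R : realType) (x y : R) : R :=
  Num.max (ln (1 + x) - ln (1 + y)) 0.

(* Summand of the double series; [s2D], [s2E] stand for sigma_D^2, sigma_E^2. *)
Definition sop_term (R : realType)
    (mD KD DeltaD s2D mE KE DeltaE s2E Theta : R) (jD jE : nat) : R :=
  KD ^+ jD * ftr_coef mD KD DeltaD jD * (KE ^+ jE * ftr_coef mE KE DeltaE jE) /
    (jD`!%:R * jE`!%:R) *
  (1 - \sum_(0 <= n < jD.+1) \sum_(0 <= q < n.+1)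
         'C(n, q)%:R * (n`!%:R * jE`!%:R)^-1 *
         expR (- ((Theta - 1) / (2 * s2D))) *
         (Theta ^+ q * (Theta - 1) ^+ (n - q) *
            Gamma (jE%:R + 1 + q%:R) * (2 * s2E) ^+ q /
          ((1 + s2E * Theta / s2D) ^+ (jE + q + 1) * (2 * s2D) ^+ n))).

(* Main.v *)
Require Import Defs.
From HB Require Import structures.
From mathcomp Require Import all_boot all_order all_algebra.
From mathcomp Require Import all_classical all_reals all_analysis.
From mathcomp Require Import measurable_realfun ring lra.
Import Order.TTheory GRing.Theory Num.Theory.
Import numFieldNormedType.Exports.

Local Open Scope classical_set_scope.
Local Open Scope ring_scope.

(* An FTR law is a mixture of Erlang laws of common rate [1 / (2 sigma^2)]: its
   density is the sum over [j] of [w_j] times the Erlang density of shape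
   [j + 1], with weights [w_j >= 0].  By independence and Tonelli, the outage
   probability is the [w_jD w_jE]-mixture of the probabilities that an Erlang
   variable of shape [jD + 1] is less than [Theta y + Theta - 1], where [y] is
   Erlang of shape [jE + 1].  Each of them is computed from the Erlang tail
   [exp (- c x) * \sum_(n <= j) (c x)^n / n!] and the binomial theorem, every
   resulting term being again a multiple of an Erlang density.  All the terms
   are nonnegative and the total is at most 1, whence the convergence of both
   series. *)

(** * Erlang densities and tails as functions: sign and derivatives *)

Section Erlang.
Context {R : realType}.
Implicit Types (c x : R) (j : nat).

(** The Erlang density of rate [c] and shape [j + 1], kept as [c] times a Poisson probability of
    mean [c * x]. *)
Definition erlang_pdf c j x := c * ((c * x) ^+ j / j`!%:R * expR (- (c * x))).

(** The probability that an Erlang variable of shape [j + 1] exceeds [x]: at most [j] Poisson events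
    occur before [x]. *)
Definition erlang_tail c j x :=
  \sum_(0 <= n < j.+1) (c * x) ^+ n / n`!%:R * expR (- (c * x)).

Lemma erlang_pdf_ge0 c j x : 0 < c -> 0 <= x -> 0 <= erlang_pdf c j x.
Proof.
move=> c0 x0; apply: mulr_ge0; first exact: ltW.
by rewrite mulr_ge0 ?expR_ge0// divr_ge0// exprn_ge0// mulr_ge0// ltW.
Qed.

Lemma erlang_tail_ge0 c j x : 0 < c -> 0 <= x -> 0 <= erlang_tail c j x.
Proof.
move=> c0 x0; apply: sumr_ge0 => n _.
by rewrite mulr_ge0 ?expR_ge0// divr_ge0// exprn_ge0// mulr_ge0// ltW.
Qed.

(** The derivative is put as a difference of consecutive densities so that it telescopes over the
    sum in [erlang_tail]. *)
Lemma is_derive_poisson c j x :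
  is_derive x 1 (fun z : R => (c * z) ^+ j.+1 / j.+1`!%:R * expR (- (c * z)))
            (erlang_pdf c j x - erlang_pdf c j.+1 x).
Proof.
have dl : is_derive x 1 (fun z : R => c * z) c.
  by apply: is_derive_eq; rewrite scaler1.
have dp : is_derive x 1 (fun z : R => (c * z) ^+ j.+1)
    (j.+1%:R * (c * x) ^+ j * c).
  rewrite (_ : (fun _ => _) = (fun z : R => c * z) ^+ j.+1); last first.
    by rewrite exprfctE.
  exact: is_derive_eq (is_deriveX j.+1 dl) _.
have de : is_derive x 1 (fun z : R => expR (- (c * z)))
    (- c * expR (- (c * x))).
  have dn : is_derive x 1 (fun z : R => - (c * z)) (- c) by exact: is_deriveN.
  apply: is_derive_eq (is_derive1_comp (is_derive_expR _) dn) _.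
  by rewrite mulrC.
have dc : is_derive x 1 (cst (j.+1`!%:R^-1) : R -> R) 0 by exact: is_derive_cst.
have := @is_deriveM _ _ _ _ x 1 _ _ (@is_deriveM _ _ _ _ x 1 _ _ dp dc) de.
move=> h; apply: (is_derive_eq h).
have j0 : j.+1%:R != 0 :> R by rewrite pnatr_eq0.
have f0 : j`!%:R != 0 :> R by rewrite pnatr_eq0 -lt0n fact_gt0.
rewrite /GRing.scale/= !fctE /erlang_pdf factS natrM exprS invfM; field.
by rewrite f0 nat1r j0.
Qed.

(** By induction: subtracting the Poisson term of index [j + 1] trades the density of index [j] for
    the next one. The minus sign makes the function a primitive of the density. *)
Lemma is_derive_erlang_tail c j x :
  is_derive x 1 (fun z => - erlang_tail c j z) (erlang_pdf c j x).
Proof.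
elim: j => [|j IH].
  have dn : is_derive x 1 (fun z : R => - (c * z)) (- c).
    have dl : is_derive x 1 (fun z : R => c * z) c.
      by apply: is_derive_eq; rewrite scaler1.
    exact: is_deriveN.
  have de := is_derive1_comp (is_derive_expR _) dn.
  rewrite (_ : (fun _ => _) = - (expR \o (fun z : R => - (c * z)))); last first.
    by apply/funext => z; rewrite /erlang_tail big_nat1 expr0 fact0 divr1 mul1r.
  apply: (is_derive_eq (is_deriveN de)).
  by rewrite /erlang_pdf expr0 fact0 divr1 mul1r /=; ring.
rewrite (_ : (fun _ => _) = (fun z => - erlang_tail c j z) -
   (fun z : R => (c * z) ^+ j.+1 / j.+1`!%:R * expR (- (c * z)))); last first.
  by apply/funext => z; rewrite /erlang_tail big_nat_recr//= opprD.
apply: (is_derive_eq (is_deriveB IH (is_derive_poisson c j x))).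
by ring.
Qed.

End Erlang.

(** * Integrals of Erlang densities, and Gamma at positive integers *)

Section ErlangIntegral.
Context {R : realType}.
Implicit Types (c x : R) (j : nat).
Notation mu := (@lebesgue_measure R).

Lemma continuous_erlang_pdf c j : continuous (erlang_pdf c j).
Proof.
move=> x; apply: cvgM; first exact: cvg_cst.
have cl : (fun z : R => c * z) z @[z --> x] --> c * x.
  by apply: cvgM; [exact: cvg_cst|exact: cvg_id].
apply: cvgM.
  apply: cvgM; last exact: cvg_cst.
  exact: (continuous_comp cl (@exprn_continuous _ j _)).
exact: (continuous_comp (cvgN cl) (@continuous_expR _ _)).
Qed.

Lemma erlang_tail0 c j : erlang_tail c j 0 = 1.
Proof.
rewrite /erlang_tail big_nat_recl// big1_seq ?addr0 => [|n _].
  by rewrite mulr0 oppr0 expR0 expr0 fact0 divr1 mulr1.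
by rewrite mulr0 expr0n/= mul0r mul0r.
Qed.

(** The next term of the exponential series, x^(n+1) / (n+1)!, is at most exp x; the extra power of
    [x] gives a bound that vanishes at infinity. *)
Lemma poisson_le_inv (n : nat) x : 0 < x ->
  x ^+ n / n`!%:R * expR (- x) <= n.+1%:R * x^-1.
Proof.
move=> x0; rewrite expRN ler_pdivrMr ?expR_gt0//.
have : x ^+ n.+1 / n.+1`!%:R <= expR x.
  by rewrite (le_trans _ (expR_ge1Dxn n (ltW x0)))// lerDr.
have n0 : 0 < n.+1%:R / x by rewrite divr_gt0.
rewrite -(ler_pM2l n0) => /(le_trans _); apply.
rewrite factS natrM invfM exprS le_eqVlt; apply/predU1P; left.
have f0 : n`!%:R != 0 :> R by rewrite pnatr_eq0 -lt0n fact_gt0.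
have x1 : x != 0 by rewrite gt_eqF.
by field; rewrite f0 x1 nat1r pnatr_eq0.
Qed.

Lemma cvg_poisson_pinfty c (n : nat) : 0 < c ->
  (c * x) ^+ n / n`!%:R * expR (- (c * x)) @[x --> +oo] --> (0 : R).
Proof.
move=> c0.
apply: (@squeeze_cvgr R (+oo)%R _ R (cst 0) (fun x => n.+1%:R * c^-1 * x^-1)).
- near=> x; have x0 : 0 < x by near: x; exact: nbhs_pinfty_gt.
  rewrite mulr_ge0 ?expR_ge0 ?divr_ge0 ?exprn_ge0 ?mulr_ge0 ?(ltW c0)
    ?(ltW x0)//=.
  by rewrite -[leRHS]mulrA -invfM; apply: poisson_le_inv; rewrite mulr_gt0.
- exact: cvg_cst.
- rewrite -[X in _ --> X](mulr0 (n.+1%:R / c)).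
  apply: cvgM; first exact: cvg_cst.
  apply: (gtr0_cvgV0 (nbhs_pinfty_gt _)).2 => //.
Unshelve. all: by end_near. Qed.

Lemma cvg_erlang_tail_pinfty c j : 0 < c ->
  erlang_tail c j x @[x --> +oo] --> (0 : R).
Proof.
move=> c0; elim: j => [|j IH].
  rewrite (_ : erlang_tail c 0 =
      fun x => (c * x) ^+ 0 / 0`!%:R * expR (- (c * x))).
    exact: cvg_poisson_pinfty.
  by apply/funext => x; rewrite /erlang_tail big_nat1.
rewrite (_ : erlang_tail c j.+1 = fun x => erlang_tail c j x +
    (c * x) ^+ j.+1 / j.+1`!%:R * expR (- (c * x))); last first.
  by apply/funext => x; rewrite /erlang_tail big_nat_recr.
by rewrite -[X in _ --> X]addr0; apply: cvgD => //; exact: cvg_poisson_pinfty.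
Qed.

Lemma measurable_erlang_pdf c j D : measurable_fun D (erlang_pdf c j).
Proof.
apply: measurable_funTS.
apply: continuous_measurable_fun. exact: continuous_erlang_pdf.
Qed.

Let derivable_erlang_tail c j x :
  derivable (fun z => - erlang_tail c j z) x 1.
Proof. exact: (@ex_derive _ _ _ _ _ _ _ (is_derive_erlang_tail c j x)). Qed.

Let derive1_erlang_tail c j x :
  derive1 (fun z => - erlang_tail c j z) x = erlang_pdf c j x.
Proof.
by rewrite derive1E (@derive_val _ _ _ _ _ _ _ (is_derive_erlang_tail c j x)).
Qed.

Let tail_continuous c j : continuous (fun z => - erlang_tail c j z).
Proof.
move=> x; apply: differentiable_continuous; apply/derivable1_diffP.
exact: derivable_erlang_tail.
Qed.

Lemma continuous_erlang_tail c j : continuous (erlang_tail c j).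
Proof.
suff : continuous (fun z => - - erlang_tail c j z).
  rewrite (_ : (fun _ => _) = erlang_tail c j)//.
  by apply/funext => z; rewrite opprK.
by move=> x; exact: cvgN (tail_continuous c j x).
Qed.

(** The primitive [- erlang_tail] rises from -1 at 0 to 0 at infinity. *)
Lemma integral_erlang_pdf c j : 0 < c ->
  (\int[mu]_(x in `]0%R, +oo[) (erlang_pdf c j x)%:E = 1)%E.
Proof.
move=> c0; rewrite integral_itv_obnd_cbnd; last first.
  by apply/measurable_EFinP; exact: measurable_erlang_pdf.
rewrite (@ge0_continuous_FTC2y _ _ (fun z => - erlang_tail c j z) 0 0).
- by rewrite erlang_tail0 -EFinB sub0r opprK.
- by move=> x x0; exact: erlang_pdf_ge0.
- by apply/continuous_subspaceT; exact: continuous_erlang_pdf.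
- by rewrite -oppr0; apply: cvgN; exact: cvg_erlang_tail_pinfty.
- by move=> x _; exact: derivable_erlang_tail.
- by apply/cvg_at_right_filter; exact: tail_continuous.
- by move=> x _; exact: derive1_erlang_tail.
Qed.

Lemma integral_erlang_pdf_itv c j x : 0 <= x ->
  (\int[mu]_(t in `[0%R, x]) (erlang_pdf c j t)%:E =
   (1 - erlang_tail c j x)%:E)%E.
Proof.
rewrite le_eqVlt => /predU1P[<-|x0].
  by rewrite set_itv1 integral_set1 erlang_tail0 subrr.
rewrite (@continuous_FTC2 _ _ (fun z => - erlang_tail c j z)) //.
- by rewrite erlang_tail0 -EFinB opprK addrC.
- by apply/continuous_subspaceT; exact: continuous_erlang_pdf.
- split.
  + by move=> z _; exact: derivable_erlang_tail.
  + by apply/cvg_at_right_filter; exact: tail_continuous.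
  + by apply/cvg_at_left_filter; exact: tail_continuous.
Qed.

Lemma erlang_tail_le1 c j x : 0 < c -> 0 <= x -> erlang_tail c j x <= 1.
Proof.
move=> c0 x0; rewrite -subr_ge0 -lee_fin -integral_erlang_pdf_itv//.
apply: integral_ge0 => t /=; rewrite in_itv/= => /andP[t0 _].
by rewrite lee_fin erlang_pdf_ge0.
Qed.

(** The integrand is n! times the Erlang density of rate 1 and index [n], whose total mass is 1. *)
Lemma Gamma_natE (n : nat) : Gamma (n.+1%:R) = n`!%:R :> R.
Proof.
rewrite /Gamma /Rintegral.
transitivity (fine (\int[mu]_(t in `]0%R, +oo[)
    (n`!%:R%:E * (erlang_pdf 1 n t)%:E)%E)).
  congr fine; apply: eq_integral => t; rewrite inE/= in_itv/= andbT => t0.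
  rewrite -EFinM; congr EFin.
  rewrite -natr1 addrK powR_mulrn ?ltW// /erlang_pdf !mul1r.
  by rewrite mulrA mulrCA divff ?mulr1// pnatr_eq0 -lt0n fact_gt0.
rewrite ge0_integralZl_EFin//.
- by rewrite integral_erlang_pdf// mule1.
- move=> t /=; rewrite in_itv/= andbT => t0.
  by rewrite lee_fin erlang_pdf_ge0// ltW.
- by apply/measurable_EFinP; exact: measurable_erlang_pdf.
Qed.

End ErlangIntegral.

(** * Integration against a law given by a density *)

Section Density.
Context d {T : measurableType d} {R : realType}.
Variables (mu nu : {measure set T -> \bar R}) (D : set T) (f : T -> R).
Hypotheses (mD : measurable D) (f0 : forall x, D x -> 0 <= f x)
  (mf : measurable_fun D f).
Hypothesis nuE : forall A, measurable A ->
  nu A = (\int[mu]_(x in A `&` D) (f x)%:E)%E.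
Local Open Scope ereal_scope.
Import HBNNSimple.

(** A simple function is a finite combination of indicators, and on an indicator the identity is
    [nuE]. *)
Let nnsfun_density (h : {nnsfun T >-> R}) :
  \int[nu]_x (h x)%:E = \int[mu]_(x in D) ((h x)%:E * (f x)%:E).
Proof.
have hx t : (h t)%:E = \sum_(y \in range h) (y * \1_(h @^-1` [set y]) t)%:E.
  by rewrite [in LHS](fimfunE h t) -fsumEFin.
transitivity (\int[mu]_(x in D)
    (\sum_(y \in range h)
      (y * \1_(h @^-1` [set y]) x)%:E * (f x)%:E)); last first.
  apply: eq_integral => t _.
  rewrite -ge0_mule_fsuml => [|y]; last exact: nnfun_muleindic_ge0.
  by rewrite -hx.
under eq_integral do rewrite hx.
rewrite ge0_integral_fsum//; last 2 first.
- by move=> r; apply/measurable_EFinP; exact: measurable_funM.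
- by move=> r x _; exact: nnfun_muleindic_ge0.
rewrite ge0_integral_fsum//; last 2 first.
- move=> r; apply: emeasurable_funM; last exact/measurable_EFinP.
  by apply/measurable_EFinP; apply: measurable_funTS; exact: measurable_funM.
- move=> r x Dx; apply: mule_ge0; first exact: nnfun_muleindic_ge0.
  by rewrite lee_fin f0.
apply: eq_fsbigr => r rh.
under eq_integral do rewrite EFinM.
rewrite integralZl_indic_nnsfun// integral_indic// setIT nuE//.
under [RHS]eq_integral do rewrite EFinM -muleA.
have r0 : (0 <= r)%R by move: rh => /[!inE] -[t _ <-].
rewrite ge0_integralZl_EFin//; last 2 first.
- by move=> x Dx; rewrite mule_ge0 ?lee_fin ?f0.
- apply: emeasurable_funM; last exact/measurable_EFinP.
  exact/measurable_EFinP/measurable_funTS.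
congr (_ * _); rewrite setIC integral_mkcondr; apply: eq_integral => x _.
by rewrite epatch_indic muleC.
Qed.

(** Monotone convergence on both sides, along simple functions increasing to [g]. *)
Lemma ge0_integral_density (g : T -> \bar R) :
    (forall x, 0 <= g x) -> measurable_fun setT g ->
  \int[nu]_x g x = \int[mu]_(x in D) (g x * (f x)%:E).
Proof.
move=> g0 mg; pose h := nnsfun_approx measurableT mg.
have hg x : (h n x)%:E @[n --> \oo] --> g x.
  exact: (@cvg_nnsfun_approx _ _ _ _ measurableT _ mg (fun x _ => g0 x) x
    Logic.I).
have hnd x m n : (m <= n)%N -> ((h m x)%:E <= (h n x)%:E).
  by move=> mn; rewrite lee_fin; apply/lefP/nd_nnsfun_approx.
transitivity (limn (fun n => \int[nu]_x (h n x)%:E)).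
  rewrite -monotone_convergence//.
  - by apply: eq_integral => x _; apply/esym/cvg_lim.
  - by move=> n; apply/measurable_EFinP.
  - by move=> n x _; rewrite lee_fin.
  - by move=> x _ m n; exact: hnd.
under eq_fun do rewrite nnsfun_density.
rewrite -monotone_convergence//.
- apply: eq_integral => x _; apply/cvg_lim => //.
  by apply: cvgeZr.
- move=> n; apply: emeasurable_funM; last exact/measurable_EFinP.
  exact/measurable_EFinP/measurable_funTS.
- by move=> n x Dx; rewrite mule_ge0 ?lee_fin ?f0.
- by move=> x Dx m n mn; rewrite lee_wpmul2r ?lee_fin ?f0//; exact: hnd.
Qed.

End Density.

Lemma ge0_integral_law d (T : measurableType d) (R : realType)
    (P : probability T R) (X : {RV P >-> R}) (D : set R) (f : R -> R)
    (g : R -> \bar R) :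
  measurable D -> (forall x, D x -> 0 <= f x) -> measurable_fun D f ->
  (forall A, measurable A ->
    P (X @^-1` A) = \int[@lebesgue_measure R]_(x in A `&` D) (f x)%:E)%E ->
  (forall x, 0 <= g x)%E -> measurable_fun setT g ->
  (\int[distribution P X]_y g y =
   \int[@lebesgue_measure R]_(y in D) (g y * (f y)%:E))%E.
Proof.
move=> mD f0 mf PX g0 mg; rewrite ge0_integral_distribution//.
(* [X] is retyped so that its law and [lebesgue_measure] are measures on the same measurable type,
   as [ge0_integral_density] requires. *)
pose X' : T -> measurableTypeR R := X.
have mX' : measurable_fun setT X' by exact: (measurable_funPT X).
pose Xm : {mfun T >-> measurableTypeR R} :=
  HB.pack X' (isMeasurableFun.Build _ _ _ _ X' mX').
rewrite -(@ge0_integral_density _ (measurableTypeR R) R lebesgue_measure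
  (pushforward P Xm) D f mD f0 mf PX g g0 mg).
by rewrite ge0_integral_pushforward.
Qed.

(** * The joint law of two independent variables *)

Lemma measurable_hypograph {R : realType} {h : R -> R} :
  measurable_fun setT h -> measurable [set z : R * R | z.2 < h z.1].
Proof.
move=> mh; rewrite -[X in measurable X]setTI.
by apply: measurable_fun_ltr => //; exact: measurableT_comp.
Qed.

(** Independence makes the law of the pair agree with the product law on rectangles, hence on all
    measurable sets; the region is then measured section by section. *)
Lemma independent_measure_lt {d} {T : measurableType d} {R : realType}
    {P : probability T R} {X Y : {RV P >-> R}} {h : R -> R} :
  independent_RV X Y -> measurable_fun setT h ->
  P [set w | X w < h (Y w)] =
  (\int[distribution P Y]_y distribution P X [set x | (x < h y)%R])%E.
Proof.
(* [Y] comes first because [product_measure1] integrates the measure of the sections over the first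
   coordinate. *)
move=> XY mh; pose Z w := (Y w, X w).
have mZ : measurable_fun setT Z by exact/measurable_fun_pair.
pose Zm : {mfun T >-> (R * R)%type} :=
  HB.pack Z (isMeasurableFun.Build _ _ _ _ Z mZ).
transitivity (pushforward P Zm [set z | z.2 < h z.1]) => //.
rewrite -(@product_measure_unique _ _ _ _ _ (distribution P Y)
  (distribution P X)).
- rewrite /product_measure1; apply: eq_integral => y _ /=.
  by congr (P _); apply/seteqP; split => w /=; rewrite /xsection/= inE.
- by move=> A B mA mB; rewrite muleC -XY//; congr (P _); rewrite setIC.
- exact: measurable_hypograph.
Qed.

(** * From real limits to extended series *)

Section Series.
Context {R : realType}.
Implicit Types u : nat -> R.

(** The definitions use a real [limn], meaningful only under convergence, whereas sums and integrals
    are exchanged in the extended reals. *)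
Lemma EFin_limn_series u : cvgn (series u) ->
  (limn (series u))%:E = (\sum_(0 <= i <oo) (u i)%:E)%E.
Proof.
move=> cu; apply/esym/cvg_lim => //.
under eq_fun do rewrite sumEFin.
by apply: cvg_EFin => //; exact: nearW.
Qed.

End Series.

(** * Bounds on Gamma and on factorials *)

Section GammaBounds.
Context {R : realType}.
Implicit Types a m : R.
Notation mu := (@lebesgue_measure R).

Lemma Gamma_ge0 a : 0 <= Gamma a.
Proof.
by apply: Rintegral_ge0 => t _; rewrite mulr_ge0 ?powR_ge0 ?expR_ge0.
Qed.

(** As [fine] sends [+oo] to 0, a real-valued integral of a nonnegative function is bounded by the
    extended one without any integrability check. *)
Lemma EFin_fine_le (x : \bar R) : (0 <= x)%E -> ((fine x)%:E <= x)%E.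
Proof. by case: x => // ?; rewrite leey. Qed.

Lemma measurable_Gamma_integrand a (D : set R) :
  measurable_fun D (fun t : R => t `^ (a - 1) * expR (- t)).
Proof.
apply: measurable_funTS; apply: measurable_funM; first exact: measurable_powR.
by apply: measurableT_comp => //; exact: measurable_funN.
Qed.

(* A divergent integral has the junk value 0 under [fine], so [Gamma a != 0]
   expresses the convergence of the defining integral. *)
Lemma Gamma_integral a : Gamma a != 0 ->
  (\int[mu]_(t in `]0%R, +oo[) (t `^ (a - 1) * expR (- t))%:E)%E = (Gamma a)%:E.
Proof.
move=> Ga0; rewrite /Gamma/Rintegral fineK//.
move: Ga0; rewrite /Gamma/Rintegral.
by case: (integral _ _ _) => //=; rewrite eqxx.
Qed.

(* [t^(j+m-1)] is at most [t^(m-1)] for [t <= 1] and [t^(j+N)] for [t >= 1]. *)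
Lemma Gamma_addn_le m (j N : nat) : Gamma m != 0 -> m <= N%:R ->
  Gamma (j%:R + m) <= Gamma m + (j + N)`!%:R.
Proof.
move=> Gm0 mN; rewrite -lee_fin EFinD -(Gamma_integral m)// -Gamma_natE.
rewrite -(Gamma_integral (j + N).+1%:R); last first.
  by rewrite Gamma_natE pnatr_eq0 -lt0n fact_gt0.
have pos b (t : R) : [set` `]0%R, +oo[] t ->
    (0 <= (t `^ (b - 1) * expR (- t))%:E :> \bar R)%E.
  by move=> _; rewrite lee_fin mulr_ge0 ?powR_ge0 ?expR_ge0.
have mb b : measurable_fun (`]0%R, +oo[ : set R)
    (fun t : R => (t `^ (b - 1) * expR (- t))%:E).
  by apply/measurable_EFinP; exact: measurable_Gamma_integrand.
rewrite -ge0_integralD; [|by []|exact: pos|exact: mb|exact: pos|exact: mb].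
apply: le_trans; first by apply: EFin_fine_le; apply: integral_ge0; exact: pos.
apply: ge0_le_integral => //.
- exact: pos.
- exact: mb.
- by apply: emeasurable_funD; exact: mb.
move=> t /=; rewrite in_itv/= andbT => t0.
rewrite -EFinD lee_fin -mulrDl ler_wpM2r ?expR_ge0//.
have [t1|t1] := leP t 1.
  rewrite ler_wpDr ?powR_ge0// ger_powR ?t0//.
  by rewrite lerBlDr subrK lerDr.
rewrite ler_wpDl ?powR_ge0// ler_powR ?(ltW t1)//.
by rewrite lerD2r -natr1 natrD -addrA lerD2l (le_trans mN) ?lerDl.
Qed.

(** The quotient of (j + N)! by j! N! is a binomial coefficient, at most 2^(j + N). *)
Lemma fact_addn_le (j N : nat) : ((j + N)`! <= N`! * 2 ^ N * (j`! * 2 ^ j))%N.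
Proof.
have binle n k : ('C(n, k) <= 2 ^ n)%N.
  have [kn|kn] := leqP k n; last by rewrite bin_small.
  rewrite -[2%N]/(1 + 1)%N expnDn (bigD1 (Ordinal (kn : (k < n.+1)%N)))//=.
  by rewrite !exp1n !muln1 leq_addr.
rewrite -(@bin_fact (j + N) j (leq_addr _ _)) addKn.
rewrite (leq_trans (leq_mul (binle _ _) (leqnn _)))//.
by rewrite expnD mulnACA mulnC [(2 ^ j * _)%N]mulnC [(2 ^ N * _)%N]mulnC mulnC.
Qed.

End GammaBounds.

(** * Growth of the FTR coefficients and convergence of the density series *)

Section FtrCoefficients.
Context {R : realType}.
Variables (m K Delta s2 : R).
Hypotheses (m0 : 0 < m) (K0 : 0 <= K) (Delta01 : 0 <= Delta <= 1)
  (s20 : 0 < s2).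
Notation mu := (@lebesgue_measure R).

Let cosD (theta : R) : 0 <= 1 + Delta * cos theta <= 2.
Proof.
have /andP[D0 D1] := Delta01.
have := cos_geN1 theta; have := cos_le1 theta => c1 cN1.
by apply/andP; split; nra.
Qed.

Let m_le_denom (theta : R) : m <= m + K + K * Delta * cos theta.
Proof.
have /andP[+ _] := cosD theta; have := K0 => k0 h.
have -> : m + K + K * Delta * cos theta = m + K * (1 + Delta * cos theta).
  by ring.
by rewrite lerDl mulr_ge0.
Qed.

Let integrand_ge0 j (theta : R) : 0 <=
  (1 + Delta * cos theta) ^+ j / (m + K + K * Delta * cos theta) `^ (j%:R + m).
Proof.
have /andP[h _] := cosD theta.
by rewrite divr_ge0 ?powR_ge0// exprn_ge0.
Qed.

Lemma ftr_coef_ge0 j : 0 <= ftr_coef m K Delta j.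
Proof.
rewrite /ftr_coef mulr_ge0//; first by rewrite divr_ge0 ?Gamma_ge0 ?pi_ge0.
by apply: Rintegral_ge0 => theta _; exact: integrand_ge0.
Qed.

(** The base of the numerator is at most 2, that of the denominator at least [m]. *)
Let integrand_le j (theta : R) :
  (1 + Delta * cos theta) ^+ j / (m + K + K * Delta * cos theta) `^ (j%:R + m)
  <= (2 / m) ^+ j / m `^ m.
Proof.
have /andP[h h2] := cosD theta.
rewrite exprMn exprVn -[leRHS]mulrA -invfM -(powR_mulrn _ (ltW m0)).
rewrite -powRD; last first.
  by rewrite gt_eqF ?ltr_wpDl.
apply: ler_pM; [exact: exprn_ge0|by rewrite invr_ge0 powR_ge0| |].
  by apply: lerXn2r; rewrite ?nnegrE.
rewrite lef_pV2 ?posrE ?powR_gt0//; last exact: lt_le_trans (m_le_denom theta).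
apply: ge0_ler_powR; rewrite ?nnegrE ?(ltW m0)//.
  by rewrite addr_ge0 ?(ltW m0).
exact: le_trans (ltW m0) (m_le_denom theta).
Qed.

(** The constant bound is integrated over an interval of length [pi], which cancels the factor
    1/pi. *)
Lemma ftr_coef_le j :
  ftr_coef m K Delta j <= Gamma (j%:R + m) * ((2 / m) ^+ j / m `^ m).
Proof.
rewrite /ftr_coef -mulrA ler_wpM2l ?Gamma_ge0//.
rewrite mulrC ler_pdivrMr ?pi_gt0// -lee_fin.
apply: le_trans.
  apply: EFin_fine_le; apply: integral_ge0 => theta _.
  by rewrite lee_fin integrand_ge0.
apply: (@le_trans _ _
  (\int[mu]_(theta in `[0%R, pi]) ((2 / m) ^+ j / m `^ m)%:E)%E).
  apply: ge0_le_integral => //.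
  - by move=> theta _; rewrite lee_fin integrand_ge0.
  - have mcos : measurable_fun setT (@cos R).
      by apply: continuous_measurable_fun; exact: continuous_cos.
    apply/measurable_EFinP/measurable_funTS.
    (* The inverse of a power becomes a power of negative exponent, to which [measurable_powR]
       applies. *)
    under eq_fun do rewrite -powRN.
    apply: measurable_funM.
      apply: measurable_funX; apply: measurable_funD => //.
      by apply: measurable_funM => //; exact: mcos.
    apply: (measurableT_comp (measurable_powR _)).
    apply: measurable_funD => //.
    by apply: measurable_funM => //; exact: mcos.
  - by move=> theta _; rewrite lee_fin integrand_le.
rewrite integral_cst//= lebesgue_measure_itv/= lte_fin pi_gt0.
by rewrite oppr0 adde0 -EFinM.
Qed.

(** Only one of the two factorials of the density is kept here: the other belongs to [erlang_pdf].
    The normalising constant m^m / Gamma(m) is left outside. *)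
Definition ftr_weight j := K ^+ j * ftr_coef m K Delta j / j`!%:R.

Lemma ftr_weight_ge0 j : 0 <= ftr_weight j.
Proof. by rewrite divr_ge0// mulr_ge0 ?exprn_ge0// ftr_coef_ge0. Qed.

(** The factorial growth of Gamma(j + m) is absorbed by the j! of the weight. Geometric growth is
    harmless for the density series, since [erlang_pdf] brings a second factorial. *)
Lemma ftr_weight_geometric : Gamma m != 0 ->
  exists A B, [/\ 0 <= A, 0 <= B & forall j, ftr_weight j <= A * B ^+ j].
Proof.
move=> Gm; pose N := (Num.truncn m).+1.
have mN : m <= N%:R by rewrite ltW// archimedean.Num.Theory.truncnS_gt.
(* In the ratio 4 K / m, a factor 2 comes from [fact_addn_le], 2 / m from [ftr_coef_le], and [K]
   from the weight itself. *)
exists ((Gamma m + N`!%:R * 2 ^+ N) / m `^ m), (4 * K / m); split.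
- by rewrite divr_ge0 ?powR_ge0// addr_ge0 ?Gamma_ge0// mulr_ge0.
- by rewrite divr_ge0 ?mulr_ge0// ltW.
move=> j; rewrite /ftr_weight.
have f0 : 0 < j`!%:R :> R by rewrite ltr0n fact_gt0.
have f1 : 1 <= j`!%:R :> R by rewrite ler1n fact_gt0.
have e1 : 1 <= 2 ^+ j :> R by rewrite exprn_ege1// ler1n.
have G : Gamma (j%:R + m) <= (Gamma m + N`!%:R * 2 ^+ N) * (j`!%:R * 2 ^+ j).
  apply: (le_trans (Gamma_addn_le _ _ _ Gm mN)); rewrite mulrDl lerD//.
    by rewrite ler_peMr ?Gamma_ge0// -[leLHS]mulr1 ler_pM.
  by rewrite -!natrX -!natrM ler_nat fact_addn_le.
rewrite ler_pdivrMr//.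
apply: (@le_trans _ _ (K ^+ j * (Gamma (j%:R + m) * ((2 / m) ^+ j / m `^ m)))).
  by rewrite ler_wpM2l ?exprn_ge0// ftr_coef_le.
apply: (@le_trans _ _ (K ^+ j * ((Gamma m + N`!%:R * 2 ^+ N) *
    (j`!%:R * 2 ^+ j) * ((2 / m) ^+ j / m `^ m)))).
  rewrite ler_wpM2l ?exprn_ge0// ler_wpM2r// divr_ge0 ?powR_ge0// exprn_ge0//.
  by rewrite divr_ge0// ltW.
rewrite (_ : 4 * K / m = 2 * (2 / m) * K); last by field; rewrite gt_eqF.
by rewrite !exprMn le_eqVlt; apply/predU1P; left; ring.
Qed.

Lemma ftr_density_termE j x :
  K ^+ j * ftr_coef m K Delta j / (j`!%:R * j`!%:R) *
    (x ^+ j / (2 * s2) ^+ j.+1) * expR (- (x / (2 * s2))) =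
  ftr_weight j * erlang_pdf (2 * s2)^-1 j x.
Proof.
rewrite /ftr_weight /erlang_pdf; set c := 2 * s2.
by rewrite (mulrC c^-1 x) expr_div_n exprS !invfM; ring.
Qed.

Lemma is_cvg_ftr_density_series x : Gamma m != 0 -> 0 <= x ->
  cvgn (series (fun j => ftr_weight j * erlang_pdf (2 * s2)^-1 j x)).
Proof.
move=> Gm x0; have [A [B [A0 B0 AB]]] := ftr_weight_geometric Gm.
set c := (2 * s2)^-1; have c0 : 0 < c by rewrite invr_gt0 mulr_gt0.
(* With the geometric bound and exp (- c x) <= 1, the terms are dominated by those of the series of
   exp (B c x), up to the factor [A * c]. *)
apply: (@series_le_cvg _ _ (fun j => A * c * exp_coeff (B * (c * x)) j)).
- by move=> j; rewrite mulr_ge0 ?ftr_weight_ge0 ?erlang_pdf_ge0.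
- move=> j; rewrite /exp_coeff/= mulr_ge0 ?(mulr_ge0 A0) ?(ltW c0)//.
  by rewrite divr_ge0// exprn_ge0// !mulr_ge0// ltW.
- move=> j; apply: (@le_trans _ _ (A * B ^+ j * erlang_pdf c j x)).
    by rewrite ler_wpM2r ?erlang_pdf_ge0.
  rewrite /erlang_pdf -!mulrA ler_wpM2l// mulrCA ler_wpM2l ?(ltW c0)//.
  rewrite /exp_coeff /= (exprMn j B (c * x)) -!mulrA ler_wpM2l ?exprn_ge0//.
  rewrite ler_wpM2l ?exprn_ge0 ?mulr_ge0 ?(ltW c0)//.
  by rewrite ler_piMr ?invr_ge0// -expR0 ler_expR oppr_le0 mulr_ge0 ?(ltW c0).
- rewrite (_ : (fun _ => _) = (A * c) *: exp_coeff (B * (c * x)))//.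
  by apply: is_cvg_seriesZ; exact: is_cvg_series_exp_coeff.
Qed.

End FtrCoefficients.

(** * Averaging an Erlang tail against another Erlang law *)

Section Overlap.
Context {R : realType}.
Variables (cD cE Theta b : R) (j k : nat).
Hypotheses (cD0 : 0 < cD) (cE0 : 0 < cE) (Theta0 : 0 < Theta) (b0 : 0 <= b).
Notation mu := (@lebesgue_measure R).
Let h y := Theta * y + b.
Let lam := cD * Theta + cE.

(** Coefficient of the Erlang density of rate [lam] and index [k + q] in the product of a tail at
    [h y] and a density at [y]; the last factor undoes the normalising constant of that density. *)
Definition overlap_coef (n q : nat) : R :=
  'C(n, q)%:R * (cD ^+ n / n`!%:R) * expR (- (cD * b)) *
  (Theta ^+ q * b ^+ (n - q)) * (cE ^+ k.+1 / k`!%:R) *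
  ((k + q)`!%:R / lam ^+ (k + q).+1).

Let lam0 : 0 < lam. Proof. by rewrite addr_gt0// mulr_gt0. Qed.

Lemma overlap_coef_ge0 n q : 0 <= overlap_coef n q.
Proof.
by rewrite /overlap_coef !mulr_ge0 ?expR_ge0 ?invr_ge0 ?exprn_ge0//; exact: ltW.
Qed.

(** The binomial theorem expands the powers of [Theta * y + b], and the two exponentials merge into
    one of rate [lam]. *)
Let tail_pdfE y : erlang_tail cD j (h y) * erlang_pdf cE k y =
  \sum_(0 <= n < j.+1) \sum_(0 <= q < n.+1)
    overlap_coef n q * erlang_pdf lam (k + q) y.
Proof.
rewrite /erlang_tail big_distrl/=; apply: eq_bigr => n _.
rewrite (_ : cD * h y = cD * b + cD * Theta * y); last by rewrite /h; ring.
rewrite opprD expRD.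
rewrite (_ : cD * b + cD * Theta * y = cD * (b + Theta * y)); last by ring.
rewrite (exprMn n cD) exprDn.
rewrite [in RHS]big_mkord big_distrr/= !big_distrl/=; apply: eq_bigr => q _.
rewrite /overlap_coef /erlang_pdf -(mulr_natl _ 'C(n, q)).
rewrite (exprMn _ Theta) (exprMn _ lam) (exprMn _ cE) (exprD y) !exprS.
rewrite (_ : expR (- (lam * y)) =
    expR (- (cD * Theta * y)) * expR (- (cE * y))).
  have l0 : lam != 0 by rewrite gt_eqF.
  have l1 : lam ^+ (k + q) != 0 by rewrite expf_neq0.
  have f0 i : i`!%:R != 0 :> R by rewrite pnatr_eq0 -lt0n fact_gt0.
  by field; rewrite !f0 l0 l1.
by rewrite -expRD /lam; congr expR; ring.
Qed.

Lemma integral_erlang_tail_pdf :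
  (\int[mu]_(y in `]0%R, +oo[)
     (erlang_tail cD j (h y) * erlang_pdf cE k y)%:E =
   (\sum_(0 <= n < j.+1) \sum_(0 <= q < n.+1) overlap_coef n q)%:E)%E.
Proof.
have pos n q y : (`]0%R, +oo[%classic : set R) y ->
    (0 <= (overlap_coef n q * erlang_pdf lam (k + q) y)%:E)%E.
  rewrite /= in_itv/= andbT => y0.
  by rewrite lee_fin mulr_ge0 ?overlap_coef_ge0// erlang_pdf_ge0// ltW.
have mf n q : measurable_fun (`]0%R, +oo[ : set R)
    (fun y => (overlap_coef n q * erlang_pdf lam (k + q) y)%:E).
  apply/measurable_EFinP; apply: measurable_funM => //.
  exact: measurable_erlang_pdf.
under eq_integral => y _.
  rewrite tail_pdfE -sumEFin; under eq_bigr do rewrite -sumEFin; over.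
rewrite ge0_integral_sum//; last 2 first.
- by move=> n; apply: emeasurable_sum => q; exact: mf.
- by move=> n y y0; apply: sume_ge0 => q _; exact: pos.
rewrite -sumEFin; apply: eq_bigr => n _.
rewrite ge0_integral_sum//; [|exact: mf|by move=> q y y0; exact: pos].
rewrite -sumEFin; apply: eq_bigr => q _.
under eq_integral do rewrite EFinM.
rewrite ge0_integralZl_EFin ?overlap_coef_ge0//.
- by rewrite integral_erlang_pdf// mule1.
- move=> y /=; rewrite in_itv/= andbT => y0.
  by rewrite lee_fin erlang_pdf_ge0// ltW.
- by apply/measurable_EFinP; exact: measurable_erlang_pdf.
Qed.

Lemma measurable_erlang_tail_comp D :
  measurable_fun D (fun y => erlang_tail cD j (h y)).
Proof.
apply: measurable_funTS.
apply: (@measurableT_comp _ _ _ _ _ _ (erlang_tail cD j) _ h).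
  by apply: continuous_measurable_fun; exact: continuous_erlang_tail.
by apply: measurable_funD => //; exact: measurable_funM.
Qed.

(** The probability that an Erlang variable falls below [h] of an independent one. The total mass 1
    splits into this integral and the tail integral, which is finite and can be subtracted. *)
Lemma integral_erlang_overlap :
  (\int[mu]_(y in `]0%R, +oo[)
     ((1 - erlang_tail cD j (h y)) * erlang_pdf cE k y)%:E =
   (1 - \sum_(0 <= n < j.+1) \sum_(0 <= q < n.+1) overlap_coef n q)%:E)%E.
Proof.
have h0 y : 0 < y -> 0 <= h y by move=> y0; rewrite addr_ge0// mulr_ge0// ltW.
have mpdf : measurable_fun (`]0%R, +oo[ : set R) (erlang_pdf cE k).
  exact: measurable_erlang_pdf.
have : (\int[mu]_(y in `]0%R, +oo[) (erlang_pdf cE k y)%:E =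
   \int[mu]_(y in `]0%R, +oo[)
     ((1 - erlang_tail cD j (h y)) * erlang_pdf cE k y)%:E +
   \int[mu]_(y in `]0%R, +oo[)
     (erlang_tail cD j (h y) * erlang_pdf cE k y)%:E)%E.
  rewrite -ge0_integralD//.
  - by apply: eq_integral => y _; rewrite -EFinD -mulrDl subrK mul1r.
  - move=> y /=; rewrite in_itv/= andbT => y0.
    rewrite lee_fin mulr_ge0 ?erlang_pdf_ge0 ?(ltW y0)//.
    by rewrite subr_ge0 erlang_tail_le1// h0.
  - apply/measurable_EFinP; apply: measurable_funM => //.
    by apply: measurable_funB => //; exact: measurable_erlang_tail_comp.
  - move=> y /=; rewrite in_itv/= andbT => y0.
    rewrite lee_fin mulr_ge0 ?erlang_pdf_ge0 ?(ltW y0)//.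
    by rewrite erlang_tail_ge0// h0.
  - apply/measurable_EFinP; apply: measurable_funM => //.
    exact: measurable_erlang_tail_comp.
rewrite integral_erlang_pdf// integral_erlang_tail_pdf EFinB => ->.
by rewrite addeK.
Qed.

End Overlap.

(** * Nonnegative double series with finite extended sum *)

Section DoubleSeries.
Context {R : realType}.
Variable t : nat -> nat -> R.
Hypothesis t0 : forall j k, 0 <= t j k.
Hypothesis tfin : (\sum_(0 <= j <oo) \sum_(0 <= k <oo) (t j k)%:E < +oo)%E.

Let inner_ge0 j : (0 <= \sum_(0 <= k <oo) (t j k)%:E)%E.
Proof. by apply: nneseries_ge0 => k _ _; rewrite lee_fin. Qed.

(** A single row is at most the whole double sum, hence finite. *)
Lemma is_cvg_inner_series j : cvgn (series (t j)).
Proof.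
apply: nnseries_is_cvg => //; apply: le_lt_trans tfin.
rewrite (@nneseriesD1 _ (fun i => \sum_(0 <= k <oo) (t i k)%:E)%E j)//=.
by apply: leeDl; apply: nneseries_ge0.
Qed.

Let outerE : (\sum_(0 <= j <oo) (limn (series (t j)))%:E)%E =
  (\sum_(0 <= j <oo) \sum_(0 <= k <oo) (t j k)%:E)%E.
Proof.
apply: eq_eseriesr => j _; rewrite EFin_limn_series//.
exact: is_cvg_inner_series.
Qed.

Lemma is_cvg_outer_series : cvgn (series (fun j => limn (series (t j)))).
Proof.
apply: nnseries_is_cvg; last by rewrite outerE.
by move=> j; rewrite -lee_fin EFin_limn_series//; exact: is_cvg_inner_series.
Qed.

Lemma EFin_double_series : (limn (series (fun j => limn (series (t j)))))%:E =
  (\sum_(0 <= j <oo) \sum_(0 <= k <oo) (t j k)%:E)%E.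
Proof. by rewrite EFin_limn_series ?outerE//; exact: is_cvg_outer_series. Qed.

End DoubleSeries.

(** * The stated summand in terms of mixture weights *)

Lemma sop_termE (R : realType) (mD KD DeltaD s2D mE KE DeltaE s2E Theta : R)
    (jD jE : nat) : 0 < s2D -> 0 < s2E -> 0 < Theta ->
  sop_term mD KD DeltaD s2D mE KE DeltaE s2E Theta jD jE =
  ftr_weight mD KD DeltaD jD * ftr_weight mE KE DeltaE jE *
  (1 - \sum_(0 <= n < jD.+1) \sum_(0 <= q < n.+1)
     overlap_coef (2 * s2D)^-1 (2 * s2E)^-1 Theta (Theta - 1) jE n q).
Proof.
move=> sD sE T0; rewrite /sop_term /ftr_weight; congr (_ * _).
  move: (ftr_coef _ _ _ jD) (ftr_coef _ _ _ jE) => dD dE.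
  by rewrite invfM; ring.
congr (_ - _); apply: eq_bigr => n _; apply: eq_bigr => q _.
rewrite (_ : jE%:R + 1 + q%:R = (jE + q).+1%:R); last first.
  by rewrite -natr1 natrD addrAC.
rewrite Gamma_natE /overlap_coef.
rewrite [X in expR (- X)]mulrC.
(* This is the merged rate [lam]. Its power of exponent [jE + q + 1], set against the power [jE + 1]
   of the rate of channel E, produces the stated denominator and the factor [(2 * s2E) ^+ q]. *)
have -> : (2 * s2D)^-1 * Theta + (2 * s2E)^-1 =
    (1 + s2E * Theta / s2D) / (2 * s2E).
  by field; rewrite !gt_eqF.
have l0 : 1 + s2E * Theta / s2D != 0.
  by rewrite gt_eqF// ltr_wpDr// divr_ge0 ?mulr_ge0 ?ltW.
rewrite !exprVn expr_div_n !addn1 !exprS (exprD (2 * s2E)).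
set X := 1 + _ in l0 *.
have f0 i : i`!%:R != 0 :> R by rewrite pnatr_eq0 -lt0n fact_gt0.
have x0 : X ^+ (jE + q) != 0 by rewrite expf_neq0.
have [D0 E0] : 2 * s2D != 0 /\ 2 * s2E != 0 by rewrite !gt_eqF ?mulr_gt0.
set a := 2 * s2D in D0 *; set b := 2 * s2E in E0 *.
have a0 : a ^+ n != 0 by rewrite expf_neq0.
have b0 : b ^+ jE != 0 by rewrite expf_neq0.
have b1 : b ^+ q != 0 by rewrite expf_neq0.
by field; rewrite !f0 l0 x0 E0 a0 b0 b1.
Qed.

(** * The FTR law as a mixture of Erlang laws *)

Section FtrLaw.
Context {R : realType}.
Variables (m K Delta s2 : R).
Hypotheses (m0 : 0 < m) (K0 : 0 <= K) (Delta01 : 0 <= Delta <= 1)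
  (s20 : 0 < s2).
Notation mu := (@lebesgue_measure R).
Let c := (2 * s2)^-1.
Let C := m `^ m / Gamma m.
Let c0 : 0 < c. Proof. by rewrite invr_gt0 mulr_gt0. Qed.

Lemma ftr_const_ge0 : 0 <= C.
Proof. by rewrite divr_ge0 ?powR_ge0 ?Gamma_ge0. Qed.

Hypothesis Gm : Gamma m != 0.

Lemma ftr_densityE x : 0 <= x ->
  (ftr_density m K Delta s2 x)%:E =
  (\sum_(0 <= j <oo) (C * ftr_weight m K Delta j * erlang_pdf c j x)%:E)%E.
Proof.
move=> x0; rewrite /ftr_density.
under eq_fun do rewrite ftr_density_termE.
rewrite EFinM EFin_limn_series; last exact: is_cvg_ftr_density_series.
rewrite -nneseriesZl; last first.
  by move=> j _; rewrite lee_fin mulr_ge0 ?ftr_weight_ge0 ?erlang_pdf_ge0.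
by apply: eq_eseriesr => j _; rewrite -EFinM mulrA.
Qed.

Let term_ge0 j x : 0 <= x -> 0 <= C * ftr_weight m K Delta j * erlang_pdf c j x.
Proof.
move=> x0; rewrite mulr_ge0 ?erlang_pdf_ge0//.
by rewrite mulr_ge0 ?ftr_const_ge0 ?ftr_weight_ge0.
Qed.

Lemma ftr_density_ge0 x : 0 <= x -> 0 <= ftr_density m K Delta s2 x.
Proof.
move=> x0; rewrite -lee_fin ftr_densityE//.
by apply: nneseries_ge0 => j _ _; rewrite lee_fin term_ge0.
Qed.

Let mterm (D : set R) j :
  measurable_fun D
    (fun x => (C * ftr_weight m K Delta j * erlang_pdf c j x)%:E).
Proof.
apply/measurable_EFinP; apply: measurable_funM => //.
exact: measurable_erlang_pdf.
Qed.

Lemma measurable_ftr_density :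
  measurable_fun (`]0%R, +oo[ : set R) (ftr_density m K Delta s2).
Proof.
apply/measurable_EFinP.
apply: (eq_measurable_fun (fun x =>
    (\sum_(0 <= j <oo) (C * ftr_weight m K Delta j * erlang_pdf c j x)%:E)%E)).
  move=> x; rewrite inE/= in_itv/= andbT => x0.
  by rewrite ftr_densityE// ltW.
apply: (@ge0_emeasurable_sum _ _ _ _ _ xpredT) => [j x|j _]; last exact: mterm.
by rewrite /= in_itv/= andbT => x0 _; rewrite lee_fin term_ge0// ltW.
Qed.

(** The distribution function at [z]: nonnegativity lets sum and integral be exchanged, and each
    term is an Erlang distribution function. *)
Lemma integral_ftr_density_itv (z : R) : 0 <= z ->
  (\int[mu]_(x in [set x : R | (x < z)%R] `&` `]0%R, +oo[)
     (ftr_density m K Delta s2 x)%:E =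
   \sum_(0 <= j <oo)
     (C * ftr_weight m K Delta j * (1 - erlang_tail c j z))%:E)%E.
Proof.
move=> z0.
have -> : [set x : R | (x < z)%R] `&` `]0%R, +oo[ = `]0%R, z[%classic.
  apply/seteqP; split => x /=; rewrite !in_itv/= andbT.
    by move=> [-> ->].
  by move=> /andP[-> ->].
under eq_integral => x xz.
  rewrite ftr_densityE; last by move: xz; rewrite inE/= in_itv/= => /andP[/ltW].
  over.
rewrite integral_nneseries//; last 2 first.
- by move=> j; exact: mterm.
- move=> j x /=; rewrite in_itv/= => /andP[x0 _].
  by rewrite lee_fin term_ge0// ltW.
apply: eq_eseriesr => j _.
under eq_integral do rewrite EFinM.
rewrite ge0_integralZl_EFin//.
- rewrite integral_itv_bndo_bndc; last first.
    by apply/measurable_EFinP; exact: measurable_erlang_pdf.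
  rewrite integral_itv_obnd_cbnd; last first.
    by apply/measurable_EFinP; exact: measurable_erlang_pdf.
  by rewrite integral_erlang_pdf_itv.
- move=> x /=; rewrite in_itv/= => /andP[x0 _].
  by rewrite lee_fin erlang_pdf_ge0// ltW.
- by apply/measurable_EFinP; exact: measurable_erlang_pdf.
- by rewrite mulr_ge0 ?ftr_const_ge0 ?ftr_weight_ge0.
Qed.

End FtrLaw.

(* With the junk value [Gamma m = 0] the density would vanish identically. *)
Lemma is_FTR_Gamma_neq0 {d} {T : measurableType d} {R : realType}
    {P : probability T R} {m K Delta s2 : R} {X : {RV P >-> R}} :
  is_FTR m K Delta s2 X -> Gamma m != 0.
Proof.
move=> /(_ _ measurableT); rewrite preimage_setT probability_setT.
apply: contra_eqN => /eqP G0; rewrite integral0_eq ?oner_eq0// => x _.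
by rewrite /ftr_density G0 invr0 mulr0 mul0r.
Qed.

(** * The outage event and its probability as an extended double series *)

Lemma secrecy_capacity_lt (R : realType) (x y r : R) :
  0 <= x -> 0 <= y -> 0 < r ->
  (secrecy_capacity x y < r) = (x < expR r * y + expR r - 1).
Proof.
move=> x0 y0 r0; rewrite /secrecy_capacity gt_max r0 andbT ltrBlDr.
have [x1 y1] : 0 < 1 + x /\ 0 < 1 + y by split; rewrite ltr_wpDr.
rewrite -[in LHS]ltr_expR expRD !lnK//.
by rewrite ltrBrDr mulrDr mulr1 [1 + x]addrC [expR r + _]addrC.
Qed.

Lemma measurable_distribution_lt d (T : measurableType d) (R : realType)
    (P : probability T R) (X : {RV P >-> R}) (h : R -> R) :
  measurable_fun setT h ->
  measurable_fun setT (fun y => distribution P X [set x | x < h y]).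
Proof.
move=> mh.
have := measurable_fun_xsection (distribution P X) (measurable_hypograph mh).
apply: eq_measurable_fun => y _ /=.
by congr (P _); apply/seteqP; split => w /=; rewrite /xsection/= inE.
Qed.

(** For [gE] equal to [y], the outage probability is the distribution function of [gD] at
    [Theta * y + b], a series over [j]; the density of [gE] is a series over [k]. All terms being
    nonnegative, Tonelli applies before the double series is known to be finite. *)
Lemma sop_series {d} {T : measurableType d} {R : realType} {P : probability T R}
    {gD gE : {RV P >-> R}} {mD KD DeltaD s2D mE KE DeltaE s2E Theta b : R} :
  0 < mD -> 0 <= KD -> 0 <= DeltaD <= 1 -> 0 < s2D ->
  0 < mE -> 0 <= KE -> 0 <= DeltaE <= 1 -> 0 < s2E ->
  0 < Theta -> 0 <= b ->
  is_FTR mD KD DeltaD s2D gD -> is_FTR mE KE DeltaE s2E gE ->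
  independent_RV gD gE ->
  P [set w | gD w < Theta * gE w + b] =
  (\sum_(0 <= j <oo) \sum_(0 <= k <oo)
     (mD `^ mD / Gamma mD * ftr_weight mD KD DeltaD j *
      (mE `^ mE / Gamma mE * ftr_weight mE KE DeltaE k) *
      (1 - \sum_(0 <= n < j.+1) \sum_(0 <= q < n.+1)
         overlap_coef (2 * s2D)^-1 (2 * s2E)^-1 Theta b k n q))%:E)%E.
Proof.
move=> mD0 KD0 DD s2D0 mE0 KE0 DE s2E0 T0 b0 FD FE ind.
have GD := is_FTR_Gamma_neq0 FD.
have GE := is_FTR_Gamma_neq0 FE.
pose h y := Theta * y + b.
have mh : measurable_fun setT h.
  by apply: measurable_funD => //; exact: measurable_funM.
have h0 y : 0 < y -> 0 <= h y by move=> y0; rewrite addr_ge0// mulr_ge0// ltW.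
set cD := (2 * s2D)^-1; set cE := (2 * s2E)^-1.
have cD0 : 0 < cD by rewrite invr_gt0 mulr_gt0.
have cE0 : 0 < cE by rewrite invr_gt0 mulr_gt0.
pose wD j := mD `^ mD / Gamma mD * ftr_weight mD KD DeltaD j.
pose wE j := mE `^ mE / Gamma mE * ftr_weight mE KE DeltaE j.
have wD0 j : 0 <= wD j by rewrite mulr_ge0 ?ftr_const_ge0 ?ftr_weight_ge0.
have wE0 j : 0 <= wE j by rewrite mulr_ge0 ?ftr_const_ge0 ?ftr_weight_ge0.
have tail0 j y : 0 < y -> 0 <= 1 - erlang_tail cD j (h y).
  by move=> y0; rewrite subr_ge0 erlang_tail_le1// h0.
rewrite (independent_measure_lt ind mh).
transitivity (\int[lebesgue_measure]_(y in `]0%R, +oo[)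
    (distribution P gD [set x | (x < h y)%R] *
     (ftr_density mE KE DeltaE s2E y)%:E))%E.
  apply: ge0_integral_law => //.
  - by move=> y /=; rewrite in_itv/= andbT => y0; rewrite ftr_density_ge0// ltW.
  - exact: measurable_ftr_density.
  - exact: measurable_distribution_lt.
pose F j k y :=
  wD j * wE k * ((1 - erlang_tail cD j (h y)) * erlang_pdf cE k y).
have F0 j k y : (`]0%R, +oo[%classic : set R) y -> (0 <= (F j k y)%:E)%E.
  rewrite /= in_itv/= andbT => y0.
  rewrite lee_fin; apply: (mulr_ge0 (mulr_ge0 (wD0 j) (wE0 k))).
  by rewrite mulr_ge0 ?tail0// erlang_pdf_ge0// ltW.
have mF j k : measurable_fun (`]0%R, +oo[ : set R) (fun y => (F j k y)%:E).
  apply/measurable_EFinP; apply: measurable_funM => //.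
  apply: measurable_funM; last exact: measurable_erlang_pdf.
  by apply: measurable_funB => //; exact: measurable_erlang_tail_comp.
transitivity (\int[lebesgue_measure]_(y in `]0%R, +oo[)
    \sum_(0 <= j <oo) \sum_(0 <= k <oo) (F j k y)%:E)%E.
  apply: eq_integral => y; rewrite inE /= in_itv/= andbT => y0.
  rewrite [X in (X * _)%E]FD; last first.
    by rewrite -set_itvNyo; exact: measurable_itv.
  rewrite integral_ftr_density_itv// ?h0// muleC -nneseriesZl; last first.
    by move=> j _; rewrite lee_fin mulr_ge0 ?tail0//; exact: wD0.
  apply: eq_eseriesr => j _.
  rewrite muleC ftr_densityE ?(ltW y0)// -nneseriesZl; last first.
    move=> k _; rewrite lee_fin mulr_ge0 ?erlang_pdf_ge0 ?(ltW y0)//.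
    exact: wE0.
  apply: eq_eseriesr => k _; rewrite -EFinM; congr EFin.
  by rewrite /F -/cE -/cD mulrACA.
(* The series over [j] leaves the integral first, then the one over [k]. *)
rewrite integral_nneseries//; last 2 first.
- move=> j; apply: (@ge0_emeasurable_sum _ _ _ _ _ xpredT) => [k y y0 _|k _].
    exact: F0.
  exact: mF.
- by move=> j y y0; apply: nneseries_ge0 => k _ _; exact: F0.
apply: eq_eseriesr => j _.
rewrite integral_nneseries//; [|exact: mF|by move=> k y y0; exact: F0].
apply: eq_eseriesr => k _.
rewrite [RHS]EFinM -integral_erlang_overlap//.
under eq_integral do rewrite EFinM.
rewrite ge0_integralZl_EFin//.
- move=> y /=; rewrite in_itv/= andbT => y0.
  by rewrite lee_fin mulr_ge0 ?erlang_pdf_ge0 ?(ltW y0)//; exact: tail0.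
- apply/measurable_EFinP.
  apply: measurable_funM; last exact: measurable_erlang_pdf.
  by apply: measurable_funB => //; exact: measurable_erlang_tail_comp.
- exact: mulr_ge0 (wD0 j) (wE0 k).
Qed.

(** The sign of the bracket is not visible in the formula; it appears once the bracket is recognised
    as the integral of a nonnegative function. *)
Lemma sop_term_ge0 (R : realType) (mD KD DeltaD s2D mE KE DeltaE s2E Theta : R)
    (jD jE : nat) :
  0 < mD -> 0 <= KD -> 0 <= DeltaD <= 1 -> 0 < s2D ->
  0 < mE -> 0 <= KE -> 0 <= DeltaE <= 1 -> 0 < s2E -> 1 <= Theta ->
  0 <= sop_term mD KD DeltaD s2D mE KE DeltaE s2E Theta jD jE.
Proof.
move=> mD0 KD0 DD s2D0 mE0 KE0 DE s2E0 T1.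
have T0 : 0 < Theta by exact: lt_le_trans T1.
have b0 : 0 <= Theta - 1 by rewrite subr_ge0.
rewrite sop_termE// mulr_ge0//; first by rewrite mulr_ge0 ?ftr_weight_ge0.
have cD0 : 0 < (2 * s2D)^-1 by rewrite invr_gt0 mulr_gt0.
have cE0 : 0 < (2 * s2E)^-1 by rewrite invr_gt0 mulr_gt0.
rewrite -lee_fin -integral_erlang_overlap//.
apply: integral_ge0 => y /=; rewrite in_itv/= andbT => y0.
rewrite lee_fin mulr_ge0 ?erlang_pdf_ge0 ?(ltW y0)// subr_ge0 erlang_tail_le1//.
by rewrite addr_ge0// mulr_ge0// ltW.
Qed.

(** * Closed form of the outage probability and convergence of its series *)

Theorem lemma2 (R : realType) (d : measure_display) (T : measurableType d)
    (P : probability T R) (gD gE : {RV P >-> R})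
    (mD KD DeltaD sigmaD mE KE DeltaE sigmaE Rs : R)
    (hmD : 0 < mD) (hKD : 0 <= KD) (hDeltaD : 0 <= DeltaD <= 1)
    (hsigmaD : 0 < sigmaD ^+ 2)
    (hmE : 0 < mE) (hKE : 0 <= KE) (hDeltaE : 0 <= DeltaE <= 1)
    (hsigmaE : 0 < sigmaE ^+ 2)
    (hRs : 0 <= Rs)
    (gD_ge0 : forall w, 0 <= gD w) (gE_ge0 : forall w, 0 <= gE w)
    (gD_FTR : is_FTR mD KD DeltaD (sigmaD ^+ 2) gD)
    (gE_FTR : is_FTR mE KE DeltaE (sigmaE ^+ 2) gE)
    (indep : independent_RV gD gE) :
  let Theta := expR Rs in
  let term := sop_term mD KD DeltaD (sigmaD ^+ 2) mE KE DeltaE (sigmaE ^+ 2)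
                Theta in
  let SOP := P [set w | gD w < Theta * gE w + Theta - 1] in
  [/\ 0 < Rs -> P [set w | secrecy_capacity (gD w) (gE w) < Rs] = SOP,
      forall jD : nat, cvgn (series (term jD)),
      cvgn (series (fun jD : nat => limn (series (term jD)))) &
      SOP = (mD `^ mD * mE `^ mE / (Gamma mD * Gamma mE) *
             limn (series (fun jD : nat => limn (series (term jD)))))%:E].
Proof.
move=> Theta term SOP.
have Theta1 : 1 <= Theta by rewrite -expR0 ler_expR.
have Theta0 : 0 < Theta by exact: expR_gt0.
have b0 : 0 <= Theta - 1 by rewrite subr_ge0.
have term0 j k : 0 <= term j k by exact: sop_term_ge0.
set C := mD `^ mD * mE `^ mE / (Gamma mD * Gamma mE).
(* Strict positivity, for which both Gamma values must be nonzero, makes it possible to divide by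
   [C] when bounding [S]. *)
have C0 : 0 < C.
  have GD : 0 < Gamma mD.
    by rewrite lt0r Gamma_ge0 (is_FTR_Gamma_neq0 gD_FTR).
  have GE : 0 < Gamma mE.
    by rewrite lt0r Gamma_ge0 (is_FTR_Gamma_neq0 gE_FTR).
  exact: divr_gt0 (mulr_gt0 (powR_gt0 _ hmD) (powR_gt0 _ hmE)) (mulr_gt0 GD GE).
pose S := (\sum_(0 <= j <oo) \sum_(0 <= k <oo) (term j k)%:E)%E.
have SOPE : SOP = (C%:E * S)%E.
  (* Regrouping exhibits [Theta - 1] as the nonnegative shift [b] of [sop_series]. *)
  transitivity (P [set w | gD w < Theta * gE w + (Theta - 1)]).
    by congr (P _); apply/funext => w; rewrite /= addrA.
  rewrite (sop_series hmD hKD hDeltaD hsigmaD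
    hmE hKE hDeltaE hsigmaE Theta0 b0 gD_FTR gE_FTR indep).
  rewrite -nneseriesZl; last first.
    by move=> j _; apply: nneseries_ge0 => k _ _; rewrite lee_fin.
  apply: eq_eseriesr => j _; rewrite -nneseriesZl; last first.
    by move=> k _; rewrite lee_fin.
  apply: eq_eseriesr => k _; rewrite -EFinM; congr EFin.
  rewrite /term sop_termE// [RHS]mulrA; congr (_ * _).
  rewrite /C; move: (Gamma mD) (Gamma mE) (ftr_weight _ _ _ j)
    (ftr_weight _ _ _ k) => GD GE wD wE.
  by rewrite invfM; ring.
(* The double sum is a probability divided by [C], hence finite; together with [term0] this yields
   the convergence of the inner and outer series. *)
have Sfin : (S < +oo)%E.
  have -> : S = (C^-1%:E * SOP)%E.
    by rewrite SOPE muleA -EFinM mulVf ?mul1e// gt_eqF.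
  rewrite lte_mul_pinfty ?lee_fin ?invr_ge0 ?(ltW C0)//.
  apply: le_lt_trans (ltry 1); apply: probability_le1.
  rewrite -[X in measurable X]setTI; apply: measurable_fun_ltr => //.
  apply: measurable_funB => //; apply: measurable_funD => //.
  exact: measurable_funM.
split.
- move=> Rs0; rewrite /SOP; congr (P _); apply/seteqP; split => w /=;
    by rewrite secrecy_capacity_lt.
- exact: is_cvg_inner_series.
- exact: is_cvg_outer_series.
- by rewrite EFinM EFin_double_series.
Qed.
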